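(* Let $n,k,m\ge 0$ be integers with $m\le n+k$, and let $\mathcal{P}$ be the two-row skew shape $(n+k,m)/(k)$. Let $\mathrm{Int}$ be the poset with element set $\{(a,b)\in\mathbb{Z}^2: 0\le a\le n-1,\ 0\le b\le m-1,\ b\le a+k-1\}$ and order $(a,b)\le(a',b')$ iff $a\le a'$ and $b\ge b'$. For each integer $t$ let $c_t$ be the product of the toggles $t_p$ (acting on $J(\mathrm{Int})$) over all $p=(a,b)\in\mathrm{Int}$ with $a+b=t$, and let $\mathrm{pro}=c_{n+m-2}\circ\cdots\circ c_1\circ c_0$ (so $c_0$ is applied first). Then there is a bijection $\Phi$ from $J(\mathrm{Int})$ to the set of standard Young tableaux of shape $\mathcal{P}$ such that $\Phi\circ\mathrm{pro}=\mathrm{Pro}\circ\Phi$, where $\mathrm{Pro}$ is Schützenberger promotion on standard Young tableaux.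
   Context: $J(P)$ denotes the set of order ideals of a poset $P$. For $p\in P$ the toggle $t_p:J(P)\to J(P)$ is: $t_p(I)=I\cup\{p\}$ if $p\notin I$ and all $p'<p$ lie in $I$; $t_p(I)=I\setminus\{p\}$ if $p\in I$ and no $p'>p$ lies in $I$; $t_p(I)=I$ otherwise. Elements with the same value of $a+b$ are pairwise non-covering, so $c_t$ is well defined. The skew shape $(n+k,m)/(k)$ has first row consisting of the cells in columns $k+1,\dots,n+k$ and second row consisting of the cells in columns $1,\dots,m$; a standard Young tableau of this shape is a bijective labeling of its $N=n+m$ cells by $1,\dots,N$ increasing along rows (left to right) and down columns. For $1\le i\le N-1$, $\rho_i$ swaps the labels $i$ and $i+1$ unless the two cells carrying them are adjacent (horizontally or vertically), in which case it does nothing; promotion is $\mathrm{Pro}=\rho_{N-1}\circ\cdots\circ\rho_2\circ\rho_1$ (so $\rho_1$ is applied first). (The poset $\mathrm{Int}$ is the poset of bounded faces of the planar Hasse diagram of $J(\mathcal{P})$, with covers between adjacent faces, as described in the paper.) *)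

(* Defs.v *)
From HB Require Import structures.
From mathcomp Require Import all_boot all_order.
From mathcomp Require Import zify.

Set Implicit Arguments.
Unset Strict Implicit.
Unset Printing Implicit Defensive.

Import Order.TTheory.

Definition is_ideal (d : Order.disp_t) (P : finPOrderType d) (I : {set P}) : bool :=
  [forall x in I, forall y : P, (y <= x)%O ==> (y \in I)].

Record ideal (d : Order.disp_t) (P : finPOrderType d) :=
  Ideal { ideal_set :> {set P}; _ : is_ideal ideal_set }.
HB.instance Definition _ (d : Order.disp_t) (P : finPOrderType d) :=
  [isSub for @ideal_set d P].
HB.instance Definition _ (d : Order.disp_t) (P : finPOrderType d) :=
  [Finite of ideal P by <:].

Definition toggle_set (d : Order.disp_t) (P : finPOrderType d)
    (p : P) (I : {set P}) : {set P} :=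
  if (p \notin I) && [forall q : P, (q < p)%O ==> (q \in I)] then p |: I
  else if (p \in I) && [forall q : P, (p < q)%O ==> (q \notin I)] then I :\ p
  else I.

Lemma toggle_set_ideal (d : Order.disp_t) (P : finPOrderType d)
  (p : P) (I : ideal P) : is_ideal (toggle_set p I).
Proof.
case: I => I idI /=; rewrite /toggle_set.
have dI x y : x \in I -> (y <= x)%O -> y \in I.
  move=> xI le_yx; move/forall_inP: idI => /(_ x xI) /forallP /(_ y) /implyP.
  exact.
case: ifP => [/andP[_ /forallP lo]|_]; last case: ifP => [/andP[_ /forallP up]|//].
- apply/forall_inP => x /setU1P xI; apply/forallP => y; apply/implyP => le_yx.
  apply/setU1P; case: xI => [ex|xI]; last by right; apply: dI le_yx.
  move: le_yx; rewrite ex le_eqVlt => /predU1P[->|lt_yp]; first by left.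
  by right; apply: (implyP (lo y)).
- apply/forall_inP => x /setD1P[/eqP x'p xI].
  apply/forallP => y; apply/implyP => le_yx.
  apply/setD1P; split; last exact: dI le_yx.
  apply/eqP => ey; move: le_yx; rewrite ey le_eqVlt => /predU1P[ex|lt_px].
    by case: x'p.
  by have := implyP (up x) lt_px; rewrite xI.
Qed.

Definition toggle (d : Order.disp_t) (P : finPOrderType d)
    (p : P) (I : ideal P) : ideal P :=
  Ideal (toggle_set_ideal p I).

(* The condition b <= a + k - 1 on integers is b < a + k on naturals, which
   avoids the truncated subtraction. *)
Record Int (n k m : nat) :=
  IntElt { int_pair : 'I_n * 'I_m; _ : int_pair.2 < int_pair.1 + k }.
HB.instance Definition _ (n k m : nat) := [isSub for @int_pair n k m].
HB.instance Definition _ (n k m : nat) := [Finite of Int n k m by <:].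

Definition int_a (n k m : nat) (p : Int n k m) : nat := (int_pair p).1.
Definition int_b (n k m : nat) (p : Int n k m) : nat := (int_pair p).2.

Definition int_le (n k m : nat) (p q : Int n k m) : bool :=
  (int_a p <= int_a q) && (int_b q <= int_b p).

Lemma int_le_refl (n k m : nat) : reflexive (@int_le n k m).
Proof. by move=> p; rewrite /int_le !leqnn. Qed.

Lemma int_le_anti (n k m : nat) : antisymmetric (@int_le n k m).
Proof.
move=> p q; rewrite /int_le /int_a /int_b => h; apply: val_inj => /=.
case: (int_pair p) (int_pair q) h => [a b] [a' b'] /= h.
by congr (_, _); apply: val_inj => /=; lia.
Qed.

Lemma int_le_trans (n k m : nat) : transitive (@int_le n k m).
Proof. by move=> q p r; rewrite /int_le; lia. Qed.

HB.instance Definition _ (n k m : nat) :=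
  Order.Le_isPOrder.Build (Order.Disp tt tt) (Int n k m)
    (@int_le_refl n k m) (@int_le_anti n k m) (@int_le_trans n k m).

(* The toggles composed here commute pairwise, so the enumeration order used
   by the fold is immaterial. *)
Definition pro_c (n k m t : nat) (I : ideal (Int n k m)) : ideal (Int n k m) :=
  foldr (@toggle _ (Int n k m)) I
    [seq p <- enum {: Int n k m} | int_a p + int_b p == t].

Definition pro (n k m : nat) (I : ideal (Int n k m)) : ideal (Int n k m) :=
  foldl (fun J t => pro_c t J) I (iota 0 (n + m).-1).

(* Cells of the skew shape la / mu, as pairs (row, column) numbered from 0; the
   column bound [head 0 la] loses nothing when la is a partition. *)
Record skew_cell (la mu : seq nat) :=
  SkewCell { cell_pair : 'I_(size la) * 'I_(head 0 la);
             _ : nth 0 mu cell_pair.1 <= cell_pair.2 < nth 0 la cell_pair.1 }.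
HB.instance Definition _ (la mu : seq nat) := [isSub for @cell_pair la mu].
HB.instance Definition _ (la mu : seq nat) := [Finite of skew_cell la mu by <:].

Definition cell_row (la mu : seq nat) (x : skew_cell la mu) : nat :=
  (cell_pair x).1.
Definition cell_col (la mu : seq nat) (x : skew_cell la mu) : nat :=
  (cell_pair x).2.

Definition skew_size (la mu : seq nat) : nat := #|{: skew_cell la mu}|.

Definition is_syt (la mu : seq nat) (T : {ffun skew_cell la mu -> nat}) : bool :=
  [&& perm_eq (codom T) (iota 1 (skew_size la mu)),
      [forall x, forall y, (cell_row x == cell_row y) &&
         (cell_col x < cell_col y) ==> (T x < T y)]
    & [forall x, forall y, (cell_col x == cell_col y) &&
         (cell_row x < cell_row y) ==> (T x < T y)]].

Record syt (la mu : seq nat) :=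
  Syt { syt_label :> {ffun skew_cell la mu -> nat}; _ : is_syt syt_label }.
HB.instance Definition _ (la mu : seq nat) := [isSub for @syt_label la mu].
HB.instance Definition _ (la mu : seq nat) := [Choice of syt la mu by <:].

Definition adjacent (la mu : seq nat) (x y : skew_cell la mu) : bool :=
  ((cell_row x == cell_row y) &&
     ((cell_col x == (cell_col y).+1) || (cell_col y == (cell_col x).+1))) ||
  ((cell_col x == cell_col y) &&
     ((cell_row x == (cell_row y).+1) || (cell_row y == (cell_row x).+1))).

Definition swap_label (i l : nat) : nat :=
  if l == i then i.+1 else if l == i.+1 then i else l.

Definition rho_label (la mu : seq nat) (i : nat)
    (T : {ffun skew_cell la mu -> nat}) : {ffun skew_cell la mu -> nat} :=
  if [exists x, exists y, [&& T x == i, T y == i.+1 & adjacent x y]] then T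
  else [ffun x => swap_label i (T x)].

Lemma rho_label_syt (la mu : seq nat) (i : nat) (T : syt la mu) :
  sorted geq la -> sorted geq mu -> 0 < i < skew_size la mu ->
  is_syt (rho_label i T).
Proof.
move=> sla smu hi; case: T => T hT /=; rewrite /rho_label.
case: ifPn => // /existsPn nadj.
have {}nadj x y : T x = i -> T y = i.+1 -> ~~ adjacent x y.
  move=> Tx Ty; have /existsPn/(_ y) := nadj x.
  by rewrite Tx Ty !eqxx.
case/and3P: hT => pT rT cT.
have {}rT x y : cell_row x = cell_row y -> cell_col x < cell_col y -> T x < T y.
  move=> e l; move/forallP: rT => /(_ x)/forallP/(_ y)/implyP; apply.
  by rewrite e eqxx l.
have {}cT x y : cell_col x = cell_col y -> cell_row x < cell_row y -> T x < T y.
  move=> e l; move/forallP: cT => /(_ x)/forallP/(_ y)/implyP; apply.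
  by rewrite e eqxx l.
have geq_tr : transitive geq by move=> a b c /=; lia.
have nth_anti (s : seq nat) a b : sorted geq s -> a <= b -> nth 0 s b <= nth 0 s a.
  move=> ss le_ab; case: (ltnP b (size s)) => hb; last by rewrite nth_default.
  apply: (sorted_leq_nth geq_tr _ 0 ss) => //; rewrite ?inE; try lia.
  by move=> c /=; lia.
have swap_mono x y : T x < T y -> ~ (T x = i /\ T y = i.+1) ->
    swap_label i (T x) < swap_label i (T y).
  by rewrite /swap_label; do ![case: eqP => ?]; lia.
have swapK l : swap_label i (swap_label i l) = l.
  rewrite /swap_label; have [->|/eqP ni] := eqVneq l i.
    by rewrite eqxx; case: eqP; lia.
  have [->|/eqP nSi] := eqVneq l i.+1; first by rewrite eqxx.
  by do ![case: eqP => //].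
apply/and3P; split.
- have -> : codom [ffun x => swap_label i (T x)] = map (swap_label i) (codom T).
    by rewrite /codom /image_mem -map_comp; apply: eq_map => x; rewrite /= ffunE.
  have /permPl := perm_map (swap_label i) pT; move=> ->.
  have inj : injective (swap_label i).
    apply: (can_inj (g := swap_label i)) => a; exact: swapK.
  apply: uniq_perm; rewrite ?(map_inj_uniq inj) ?iota_uniq // => l.
  rewrite -{1}[l]swapK (mem_map inj) !mem_iota /swap_label.
  by do ![case: eqP => ?]; lia.
- apply/forallP => x; apply/forallP => y; apply/implyP => /andP[/eqP e l].
  rewrite !ffunE; apply: swap_mono; first exact: rT.
  case=> Tx Ty; have := nadj x y Tx Ty; rewrite /adjacent e eqxx /=.
  case: (ltnP (cell_col x).+1 (cell_col y)) => [lt|ge]; last by lia.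
  move=> _.
  have hlt : (cell_col x).+1 < head 0 la.
    by apply: ltn_trans lt _; apply: ltn_ord.
  have hz : nth 0 mu (cell_pair x).1 <= Ordinal hlt < nth 0 la (cell_pair x).1.
    have := valP x; have := valP y; move: e lt; rewrite /cell_row /cell_col /=.
    by move=> <-; lia.
  pose z := @SkewCell la mu ((cell_pair x).1, Ordinal hlt) hz.
  have h1 : T x < T z by apply: rT; rewrite /cell_row /cell_col //=.
  have h2 : T z < T y by apply: rT; rewrite -?e /cell_row /cell_col //=.
  by lia.
- apply/forallP => x; apply/forallP => y; apply/implyP => /andP[/eqP e l].
  rewrite !ffunE; apply: swap_mono; first exact: cT.
  case=> Tx Ty; have := nadj x y Tx Ty; rewrite /adjacent e eqxx /=.
  case: (ltnP (cell_row x).+1 (cell_row y)) => [lt|ge]; last by lia.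
  move=> _.
  have hlt : (cell_row x).+1 < size la.
    by apply: ltn_trans lt _; apply: ltn_ord.
  have hz : nth 0 mu (Ordinal hlt) <= (cell_pair x).2 < nth 0 la (Ordinal hlt).
    have := nth_anti mu _ _ smu (leqnSn (cell_row x)).
    have := nth_anti la _ _ sla (ltnW lt).
    have := valP x; have := valP y; move: e; rewrite /cell_row /cell_col /=.
    by lia.
  pose z := @SkewCell la mu (Ordinal hlt, (cell_pair x).2) hz.
  have h1 : T x < T z by apply: cT; rewrite /cell_row /cell_col //=.
  have h2 : T z < T y by apply: cT; rewrite -?e /cell_row /cell_col //=.
  by lia.
Qed.

(* By [rho_label_syt], the default value T is never used when la and mu are
   partitions and 1 <= i <= N - 1. *)
Definition rho (la mu : seq nat) (i : nat) (T : syt la mu) : syt la mu :=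
  insubd T (rho_label i T).

Definition Pro (la mu : seq nat) (T : syt la mu) : syt la mu :=
  foldl (fun U i => rho i U) T (iota 1 (skew_size la mu).-1).

Lemma skew_size_two_row (n k m : nat) :
  m <= n + k -> skew_size [:: n + k; m] [:: k] = n + m.
Proof.
move=> hm; rewrite /skew_size -[RHS](_ : #|{: 'I_n + 'I_m}| = _); last first.
  by rewrite card_sum !card_ord.
have h0 (j : 'I_n) : k + j < n + k by rewrite addnC ltn_add2r.
have h1 (j : 'I_m) : j < n + k by apply: leq_trans hm.
have g0 (j : 'I_n) : nth 0 [:: k] (@Ordinal 2 0 isT) <= Ordinal (h0 j)
    < nth 0 [:: n + k; m] (@Ordinal 2 0 isT).
  by rewrite /= h0 leq_addr.
have g1 (j : 'I_m) : nth 0 [:: k] (@Ordinal 2 1 isT) <= Ordinal (h1 j)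
    < nth 0 [:: n + k; m] (@Ordinal 2 1 isT).
  by rewrite /= ltn_ord.
pose f (s : 'I_n + 'I_m) : skew_cell [:: n + k; m] [:: k] :=
  match s with
  | inl j => @SkewCell [:: n + k; m] [:: k]
               (@Ordinal 2 0 isT, Ordinal (h0 j)) (g0 j)
  | inr j => @SkewCell [:: n + k; m] [:: k]
               (@Ordinal 2 1 isT, Ordinal (h1 j)) (g1 j)
  end.
symmetry; apply: (@bij_eq_card _ _ f); apply: inj_card_bij.
  move=> [j|j] [j'|j'] //= /(congr1 (fun x => (cell_row x, cell_col x))) [] //.
  - by move/addnI/val_inj => ->.
  - by move=> e; congr (inr _); apply: val_inj.
apply: (@leq_trans #|codom f|); last by rewrite leq_image_card.
apply/subset_leq_card/subsetP => x _; apply/codomP.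
case: x => [[[[|[|//]] hr] [c hc]] /= hx].
- have hj : c - k < n by move: (hx); rewrite /=; lia.
  exists (inl (Ordinal hj)); apply: val_inj => /=.
  by congr (_, _); apply: val_inj => //=; move: hx; rewrite /=; lia.
- have hj : c < m by move: (hx); rewrite /=; lia.
  exists (inr (Ordinal hj)); apply: val_inj => /=.
  by congr (_, _); apply: val_inj.
Qed.

(* Main.v *)
Require Import Defs.
From mathcomp Require Import all_boot all_order.
From mathcomp Require Import zify.

(** A tableau [T] is determined by which first-row labels are smaller than which
    second-row labels. Writing [T1 a] and [T2 b] for the labels of the [a]-th
    cell of the first row and the [b]-th cell of the second row, the pairs
    [(a, b)] with [b >= a + k] always satisfy [T1 a < T2 b], and the others form
    [Int]; hence [T |-> {(a, b) in Int | T1 a < T2 b}] is a bijection onto the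
    order ideals, whose inverse labels cells by their rank in the total order
    that an ideal defines. The toggle at [(a, b)] acts nontrivially exactly when
    [T1 a] and [T2 b] are consecutive labels, and counting the smaller labels
    shows that these are then [a + b + 1] and [a + b + 2]. So at most one toggle
    in [c_t] acts nontrivially, and it does what [rho_(t+1)] does: the bijection
    intertwines [c_t] and [rho_(t+1)] for each [t]. *)

Set Implicit Arguments.
Unset Strict Implicit.
Unset Printing Implicit Defensive.

Import Order.TTheory.

(** * Ranks in a finite total order *)

Lemma count_leq_iota1 v N : count (leq^~ v) (iota 1 N) = minn v N.
Proof.
elim: N => [|N IHN]; first by rewrite minn0.
by rewrite -[N.+1]addn1 iotaD count_cat IHN /=; lia.
Qed.

Lemma sum_ord_ltn n A : A <= n -> \sum_(i < n) (i < A) = A.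
Proof.
elim: n A => [|n IHn] A leAn; first by rewrite big_ord0; lia.
rewrite big_ord_recr /=; case: (ltnP n A) => hA.
  rewrite (eq_bigr (fun=> 1)) => [|i _]; last by have := ltn_ord i; lia.
  by rewrite sum1_card card_ord; lia.
by rewrite IHn // addn0.
Qed.

(** Principal down-sets of a total order are nested; when [y] lies strictly below [x], the element
    [x] itself makes the inclusion strict. *)
Lemma rank_leq (S : finType) (le : rel S) :
    total le -> transitive le -> antisymmetric le ->
  forall x y, (#|[set z | le z x]| <= #|[set z | le z y]|) = le x y.
Proof.
move=> le_tot le_tr le_anti x y; case: (boolP (le x y)) => [lexy | nlexy].
  by apply/subset_leq_card/subsetP => z; rewrite !inE => /le_tr; apply.
have /orP[|leyx] := le_tot x y; first by rewrite (negPf nlexy).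
apply/negbTE; rewrite -ltnNge; apply/proper_card/properP; split.
  by apply/subsetP => z; rewrite !inE => /le_tr; apply.
exists x; rewrite inE ?(negPf nlexy) //.
by have := le_tot x x; rewrite orbb.
Qed.

(** Ranks are distinct and lie between 1 and [#|S|], since each element counts itself; so they
    exhaust that interval. *)
Lemma perm_codom_rank (S : finType) (le : rel S) :
    total le -> transitive le -> antisymmetric le ->
  perm_eq (codom [ffun x => #|[set z | le z x]|]) (iota 1 #|S|).
Proof.
move=> le_tot le_tr le_anti; set f := finfun _.
have fE x y : (f x <= f y) = le x y by rewrite !ffunE rank_leq.
have f_inj : injective f.
  by move=> x y e; apply: le_anti; rewrite -!fE e leqnn.
have uf : uniq (codom f) by apply/injectiveP.
have sub : {subset codom f <= iota 1 #|S|}.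
  move=> _ /codomP[x ->]; rewrite mem_iota ffunE add1n ltnS max_card andbT.
  by apply/card_gt0P; exists x; rewrite inE; have := le_tot x x; rewrite orbb.
apply: uniq_perm; rewrite ?iota_uniq //.
by have [|_] := uniq_min_size uf sub; rewrite // size_iota size_codom.
Qed.

(** * Labels of a standard tableau *)

Section SytLabels.

Variables (la mu : seq nat) (T : syt la mu).

Lemma syt_perm : perm_eq (codom T) (iota 1 (skew_size la mu)).
Proof. by case: T => U /= /and3P[]. Qed.

Lemma syt_inj : injective T.
Proof.
apply/injectiveP; rewrite /injectiveb /dinjectiveb.
by rewrite (perm_uniq syt_perm) iota_uniq.
Qed.

Lemma syt_row x y :
  cell_row x = cell_row y -> cell_col x < cell_col y -> T x < T y.
Proof.
case: T => U /= /and3P[_ /forallP/(_ x)/forallP/(_ y)/implyP rU _] e l.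
by apply: rU; rewrite e eqxx.
Qed.

Lemma syt_col x y :
  cell_col x = cell_col y -> cell_row x < cell_row y -> T x < T y.
Proof.
case: T => U /= /and3P[_ _ /forallP/(_ x)/forallP/(_ y)/implyP cU] e l.
by apply: cU; rewrite e eqxx.
Qed.

(** The labels are exactly 1 to N, so a label equals its own rank. This recovers a tableau from
    comparisons of labels alone. *)
Lemma card_label_leq x : #|[set y | T y <= T x]| = T x.
Proof.
have : T x \in codom T by apply: codom_f.
rewrite (perm_mem syt_perm) mem_iota => hx.
rewrite cardsE cardE size_filter -enumT -(count_map T (leq^~ (T x))) -codomE.
have /permP -> := syt_perm; rewrite count_leq_iota1; lia.
Qed.

End SytLabels.

(** * Cells of the two-row shape *)

Section TwoRow.

Variables n k m : nat.
Hypothesis hm : m <= n + k.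

Local Notation cell := (skew_cell [:: n + k; m] [:: k]).
Local Notation tableau := (syt [:: n + k; m] [:: k]).
Local Notation poset := (Int n k m).

Fact cell0_col (a : 'I_n) : k + a < n + k.
Proof. by have := ltn_ord a; lia. Qed.

Fact cell1_col (b : 'I_m) : b < n + k.
Proof. by have := ltn_ord b; lia. Qed.

Fact cell0_proof (a : 'I_n) :
  nth 0 [:: k] (@Ordinal 2 0 isT) <= Ordinal (cell0_col a)
    < nth 0 [:: n + k; m] (@Ordinal 2 0 isT).
Proof. by have := ltn_ord a; rewrite /=; lia. Qed.

Fact cell1_proof (b : 'I_m) :
  nth 0 [:: k] (@Ordinal 2 1 isT) <= Ordinal (cell1_col b)
    < nth 0 [:: n + k; m] (@Ordinal 2 1 isT).
Proof. by have := ltn_ord b; rewrite /=; lia. Qed.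

Definition cell0 (a : 'I_n) : cell :=
  @SkewCell [:: n + k; m] [:: k] (@Ordinal 2 0 isT, Ordinal (cell0_col a))
    (cell0_proof a).

Definition cell1 (b : 'I_m) : cell :=
  @SkewCell [:: n + k; m] [:: k] (@Ordinal 2 1 isT, Ordinal (cell1_col b))
    (cell1_proof b).

Definition cell_of (s : 'I_n + 'I_m) : cell :=
  match s with inl a => cell0 a | inr b => cell1 b end.

Lemma cell_of_inj : injective cell_of.
Proof.
move=> [j|j] [j'|j'] /(congr1 (fun x => (cell_row x, cell_col x))) [] //.
  by move/addnI/val_inj => ->.
by move=> e; congr (inr _); apply: val_inj.
Qed.

Lemma cell_of_bij : bijective cell_of.
Proof.
apply: inj_card_bij cell_of_inj _.
by have := skew_size_two_row hm; rewrite /skew_size card_sum !card_ord => ->.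
Qed.

Lemma cell_ofP x : exists s, x = cell_of s.
Proof. by have [g _ gK] := cell_of_bij; exists (g x); rewrite gK. Qed.

Lemma cell0_inj : injective cell0.
Proof. by move=> a a' e; have [] := @cell_of_inj (inl a) (inl a') e. Qed.

Lemma cell1_inj : injective cell1.
Proof. by move=> b b' e; have [] := @cell_of_inj (inr b) (inr b') e. Qed.

(** * Comparing and counting labels in two rows *)

Section Labels.

Variable T : tableau.

Lemma label_cell0_lt (a a' : 'I_n) : (T (cell0 a) < T (cell0 a')) = (a < a').
Proof.
have lt0 (c c' : 'I_n) : c < c' -> T (cell0 c) < T (cell0 c').
  by move=> l; apply: syt_row; rewrite /cell_col //= ltn_add2l.
case: (ltngtP a a') => [/lt0->//|/lt0|/val_inj->]; last by rewrite ltnn.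
lia.
Qed.

Lemma label_cell1_lt (b b' : 'I_m) : (T (cell1 b) < T (cell1 b')) = (b < b').
Proof.
have lt1 (c c' : 'I_m) : c < c' -> T (cell1 c) < T (cell1 c').
  by move=> l; apply: syt_row.
case: (ltngtP b b') => [/lt1->//|/lt1|/val_inj->]; last by rewrite ltnn.
lia.
Qed.

Lemma label_cell01_neq a b : T (cell0 a) <> T (cell1 b).
Proof. by move/syt_inj/(@cell_of_inj (inl a) (inr b)). Qed.

Lemma label_cell01_lt (a : 'I_n) (b : 'I_m) :
  a + k <= b -> T (cell0 a) < T (cell1 b).
Proof.
(* The first-row cell directly above [cell1 b] has index [b - k]; here [k <= b], so the subtraction
   does not truncate. *)
move=> le_ab; have hb : b - k < n by have := ltn_ord b; lia.
apply: (@leq_ltn_trans (T (cell0 (Ordinal hb)))).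
  by rewrite leqNgt label_cell0_lt -leqNgt /=; lia.
by apply: syt_col; rewrite // /cell_col /=; lia.
Qed.

Lemma label_rank x :
  T x = \sum_(a < n) (T (cell0 a) <= T x) + \sum_(b < m) (T (cell1 b) <= T x).
Proof.
rewrite -[LHS]card_label_leq -sum1dep_card big_mkcond /=.
rewrite (reindex cell_of) /=; last exact: onW_bij cell_of_bij.
by rewrite big_sumType.
Qed.

Lemma label_rank_prefix x A B : A <= n -> B <= m ->
  (forall a : 'I_n, (T (cell0 a) <= T x) = (a < A)) ->
  (forall b : 'I_m, (T (cell1 b) <= T x) = (b < B)) -> T x = A + B.
Proof.
move=> hA hB h0 h1; rewrite label_rank.
rewrite (eq_bigr (fun a : 'I_n => (a < A) : nat)) => [|a _]; last by rewrite h0.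
rewrite sum_ord_ltn //; congr (_ + _).
rewrite (eq_bigr (fun b : 'I_m => (b < B) : nat)) => [|b _]; last by rewrite h1.
exact: sum_ord_ltn.
Qed.

End Labels.

(** * From tableaux to order ideals, injectively *)

Definition lbl0 (T : tableau) (p : poset) := T (cell0 (int_pair p).1).
Definition lbl1 (T : tableau) (p : poset) := T (cell1 (int_pair p).2).

Definition inv_set (T : tableau) : {set poset} := [set p | lbl0 T p < lbl1 T p].

(** Going down in [Int] lowers [a] and raises [b], hence lowers the first-row label and raises the
    second-row one. *)
Lemma inv_set_ideal T : is_ideal (inv_set T).
Proof.
apply/forall_inP => p; rewrite inE => lt_p; apply/forallP => q.
apply/implyP => /andP[le_a le_b]; rewrite inE.
have := label_cell0_lt T (int_pair p).1 (int_pair q).1.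
have := label_cell1_lt T (int_pair q).2 (int_pair p).2.
by move: lt_p le_a le_b; rewrite /lbl0 /lbl1 /int_a /int_b; lia.
Qed.

Definition inv_ideal (T : tableau) : ideal poset := Ideal (inv_set_ideal T).

Lemma in_inv_ideal T p : (p \in (inv_ideal T : {set _})) = (lbl0 T p < lbl1 T p).
Proof. by rewrite inE. Qed.

Lemma ideal_inj (I I' : ideal poset) : (I : {set _}) =i I' -> I = I'.
Proof. by move=> e; apply/val_inj/setP. Qed.

(** Comparisons within a row are forced, as are those with [a + k <= b]; the ideal records all the
    others, and comparisons determine the labels by [card_label_leq]. *)
Lemma inv_ideal_inj : injective inv_ideal.
Proof.
move=> T T' eJ.
have e01 a b : (T (cell0 a) < T (cell1 b)) = (T' (cell0 a) < T' (cell1 b)).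
  have [le_ab|lt_ba] := leqP (a + k) b; first by rewrite !label_cell01_lt.
  pose p : poset := @IntElt n k m (a, b) lt_ba.
  have := in_inv_ideal T p; have := in_inv_ideal T' p.
  by rewrite eJ /lbl0 /lbl1 /= => -> ->.
have e10 a b : (T (cell1 b) < T (cell0 a)) = (T' (cell1 b) < T' (cell0 a)).
  have := e01 a b; have := @label_cell01_neq T a b.
  have := @label_cell01_neq T' a b; lia.
have eT x y : (T x < T y) = (T' x < T' y).
  have [[a|b] ->] := cell_ofP x; have [[a'|b'] ->] := cell_ofP y => //=.
    by rewrite !label_cell0_lt.
  by rewrite !label_cell1_lt.
apply/val_inj/ffunP => x /=.
rewrite -(card_label_leq T) -(card_label_leq T'); apply: eq_card => y.
by rewrite !inE leqNgt eT -leqNgt.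
Qed.

(** * From order ideals to tableaux *)

Section Surjectivity.

Variable I : ideal poset.

(* [Int] omits the pairs with [a + k <= b], where [T1 a < T2 b] is forced. *)
Definition ext_ideal (a : 'I_n) (b : 'I_m) :=
  (a + k <= b) || [exists p in (I : {set _}), int_pair p == (a, b)].

Lemma ext_idealE p : ext_ideal (int_pair p).1 (int_pair p).2 = (p \in (I : {set _})).
Proof.
rewrite /ext_ideal leqNgt (valP p) /=; apply/exists_inP/idP => [[q qI]|pI].
  by rewrite -surjective_pairing => /eqP/val_inj <-.
by exists p; rewrite // -surjective_pairing.
Qed.

(** If [(a', b')] is not a forced pair, then neither is [(a, b)]; both lie in [Int] and the ideal
    property applies. *)
Lemma ext_ideal_down (a a' : 'I_n) (b b' : 'I_m) :
  a' <= a -> b <= b' -> ext_ideal a b -> ext_ideal a' b'.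
Proof.
move=> le_a le_b; case: (ltnP b' (a' + k)) => [hb'|]; last by rewrite /ext_ideal => ->.
have hb : b < a + k by lia.
pose p : poset := @IntElt n k m (a, b) hb.
pose q : poset := @IntElt n k m (a', b') hb'.
rewrite (ext_idealE p) (ext_idealE q).
case: I => S /= /forall_inP idS /idS/forallP/(_ q)/implyP; apply.
by rewrite /Order.le /= /int_le /int_a /int_b /= le_a le_b.
Qed.

(** The order in which the cells are to be labelled: a shuffle of the two rows, with cross-row
    comparisons dictated by the ideal. *)
Definition word_le (s s' : 'I_n + 'I_m) : bool :=
  match s, s' with
  | inl a, inl a' => a <= a'
  | inl a, inr b => ext_ideal a b
  | inr b, inl a => ~~ ext_ideal a b
  | inr b, inr b' => b <= b'
  end.

Lemma word_le_total : total word_le.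
Proof.
by move=> [a|b] [a'|b'] /=; rewrite ?leq_total ?orbN // orNb.
Qed.

Lemma word_le_anti : antisymmetric word_le.
Proof.
move=> [a|b] [a'|b'] /=; rewrite ?andbN ?andNb // -eqn_leq => /eqP/val_inj -> //.
Qed.

(** Each case mixing the two rows is [ext_ideal_down] or a contrapositive of it. *)
Lemma word_le_trans : transitive word_le.
Proof.
move=> [a|b] [a'|b'] [a''|b''] //=; try lia.
- by move=> le; apply: ext_ideal_down le (leqnn _).
- by move=> h le; apply: contra h; apply: ext_ideal_down.
- move=> h h'; rewrite leqNgt; apply: contra h => lt; move: h'.
  by apply: ext_ideal_down => //; lia.
- move=> h h'; rewrite leqNgt; apply: contra h' => lt; move: h.
  by apply: ext_ideal_down => //; lia.
- by move=> h h'; move: h; apply: ext_ideal_down.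
- by move=> h; apply: contra; apply: ext_ideal_down.
Qed.

Lemma inv_ideal_surj : exists T, inv_ideal T == I.
Proof.
have [g cK gK] := cell_of_bij.
pose le x y := word_le (g x) (g y).
have le_tot : total le by move=> x y; apply: word_le_total.
have le_tr : transitive le by move=> y x z; apply: word_le_trans.
have le_anti : antisymmetric le.
  by move=> x y /word_le_anti; apply: (can_inj gK).
pose f : {ffun cell -> nat} := [ffun x => #|[set z | le z x]|].
have fE x y : (f x < f y) = ~~ le y x by rewrite ltnNge !ffunE rank_leq.
have f_syt : is_syt f.
  apply/and3P; split; first exact: perm_codom_rank.
  - apply/forallP => x; apply/forallP => y; apply/implyP; rewrite fE /le.
    rewrite -[x]gK -[y]gK !cK.
    by case: (g x) (g y) => [a|b] [a'|b'] //=; rewrite /cell_col /= -ltnNge; lia.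
  - apply/forallP => x; apply/forallP => y; apply/implyP; rewrite fE /le.
    rewrite -[x]gK -[y]gK !cK.
    case: (g x) (g y) => [a|b] [a'|b'] //=; rewrite /cell_col ?andbF //=.
    (* Cells of different rows share a column only if [k + a = b], which is a forced pair. *)
    by move=> h; rewrite negbK /ext_ideal; apply/orP; left; lia.
exists (Syt f_syt); apply/eqP/ideal_inj => p.
rewrite in_inv_ideal /lbl0 /lbl1 /= fE /le.
by rewrite (cK (inl _)) (cK (inr _)) /= negbK ext_idealE.
Qed.

End Surjectivity.

(** * Consecutive labels and their swaps *)

Definition active i (T : tableau) (p : poset) :=
  ((lbl0 T p == i) && (lbl1 T p == i.+1)) ||
  ((lbl0 T p == i.+1) && (lbl1 T p == i)).

(** The labels up to the smaller of the two fill initial segments of the rows, of lengths [a + 1]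
    and [b], or [a] and [b + 1]. *)
Lemma active_rank i T p : active i T p -> i = (int_a p + int_b p).+1.
Proof.
rewrite /active /lbl0 /lbl1 /int_a /int_b.
case: (int_pair p) => a b /= act.
have h0 a' := label_cell0_lt T a a'; have h1 b' := label_cell1_lt T b b'.
have h01 a' := @label_cell01_neq T a' b; have h10 b' := @label_cell01_neq T a b'.
have ha := ltn_ord a; have hb := ltn_ord b.
case/orP: act => /andP[/eqP ex /eqP ey].
  have := @label_rank_prefix T (cell0 a) a.+1 b; rewrite ex addSn; apply=> //.
  - exact: ltnW.
  - by move=> a'; have := label_cell0_lt T a a'; rewrite ex; lia.
  - move=> b'; have := label_cell1_lt T b' b; have := h10 b'; rewrite ex ey; lia.
have := @label_rank_prefix T (cell1 b) a b.+1; rewrite ey addnS; apply=> //.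
- exact: ltnW.
- by move=> a'; have := label_cell0_lt T a' a; have := h01 a'; rewrite ex ey; lia.
- move=> b'; have := label_cell1_lt T b b'; rewrite ey; lia.
Qed.

(** The labels [i] and [i.+1] determine their two cells, one in each row, and these determine the
    pair. *)
Lemma active_uniq i T p q : active i T p -> active i T q -> p = q.
Proof.
have ne a b := @label_cell01_neq T a b.
rewrite /active /lbl0 /lbl1 => hp hq; apply: val_inj => /=.
move: (int_pair p) (int_pair q) hp hq => [a b] [a' b'] /=.
have e0 : T (cell0 a) = T (cell0 a') -> a = a' by move/syt_inj/cell0_inj.
have e1 : T (cell1 b) = T (cell1 b') -> b = b' by move/syt_inj/cell1_inj.
move: (ne a b') (ne a' b) => n1 n2 hp hq.
by congr (_, _); [apply: e0 | apply: e1]; lia.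
Qed.

Lemma rho_labelE i (T : tableau) :
  0 < i < n + m -> (rho i T : {ffun _}) = rho_label i T.
Proof.
move=> hi; rewrite /rho [LHS](insubdK T) //; apply: rho_label_syt => //=.
  by rewrite hm.
by rewrite skew_size_two_row.
Qed.

Lemma active_swap i T p : 0 < i < n + m -> active i T p ->
  forall x, rho i T x = swap_label i (T x).
Proof.
move=> hi act x; rewrite rho_labelE // /rho_label; case: ifP; rewrite ?ffunE //.
case/existsP => z /existsP[w /and3P[/eqP ez /eqP ew]].
move: act; rewrite /active /lbl0 /lbl1 -ew -ez.
rewrite !(inj_eq (@syt_inj _ _ T)).
(* The cells lie in different rows, so adjacency would force equal columns [k + a = b], against
   [b < a + k]. *)
by case/orP => /andP[/eqP<- /eqP<-]; have := valP p;
  rewrite /adjacent /cell_col /=; lia.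
Qed.

Lemma active_rho i T p :
  0 < i < n + m -> active i T p -> active i (rho i T) p.
Proof.
move=> hi act; have e := active_swap hi act.
move: act; rewrite /active /lbl0 /lbl1 !e /swap_label.
by do ![case: eqP => ?]; lia.
Qed.

(** Swapping [i] and [i.+1] reverses only the comparison between the two cells carrying them. *)
Lemma in_inv_ideal_rho i T q : 0 < i < n + m ->
  (q \in (inv_ideal (rho i T) : {set _})) =
  (q \in (inv_ideal T : {set _})) (+) active i T q.
Proof.
move=> hi; rewrite !in_inv_ideal.
have [act|nact] := boolP (active i T q).
  have e := active_swap hi act; move: act.
  rewrite /active /lbl0 /lbl1 !e /swap_label.
  by do ![case: eqP => ?]; lia.
rewrite addbF; move: nact; rewrite /active /lbl0 /lbl1 rho_labelE // /rho_label.
have := @label_cell01_neq T (int_pair q).1 (int_pair q).2.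
case: ifP => // _; rewrite !ffunE /swap_label.
by do ![case: eqP => ?]; lia.
Qed.

(** * Toggles as label swaps *)

Lemma int_ltE (p q : poset) : (p < q)%O = (p != q) && int_le p q.
Proof. by rewrite lt_neqAle. Qed.

Lemma int_pair_lt (p q : poset) : (int_a p < int_a q) && (int_b q <= int_b p) ||
  (int_a p <= int_a q) && (int_b q < int_b p) -> (p < q)%O.
Proof.
rewrite int_ltE /int_le => h; apply/andP; split; last by lia.
by apply/eqP => e; move: h; rewrite e; lia.
Qed.

Lemma lt_int_pair (p q : poset) : (p < q)%O ->
  (int_a p < int_a q) && (int_b q <= int_b p) ||
  (int_a p <= int_a q) && (int_b q < int_b p).
Proof.
rewrite int_ltE => /andP[ne le]; move: (le); rewrite /int_le.
suff : ~~ int_le q p by rewrite /int_le; lia.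
by apply: contra ne => le'; apply/eqP/int_le_anti; rewrite le le'.
Qed.

(** Here the second-row cell precedes the first-row one, and the elements below [p] show that no
    label falls between them; counting initial segments then gives [a + b + 1] and [a + b + 2]. *)
Lemma addable_active T p : p \notin (inv_ideal T : {set _}) ->
  (forall q : poset, (q < p)%O -> q \in (inv_ideal T : {set _})) ->
  active (int_a p + int_b p).+1 T p.
Proof.
rewrite in_inv_ideal => np lo.
have hp := valP p.
(* The pair [(a', b)] either belongs to [Int], and is then below [p], or is forced. *)
have lo0 (a' : 'I_n) : a' < int_a p -> T (cell0 a') < lbl1 T p.
  move=> lt_a; have [hb|hb] := ltnP (int_b p) (a' + k); last first.
    exact: label_cell01_lt.
  have := lo (@IntElt n k m (a', (int_pair p).2) hb).
  rewrite in_inv_ideal; apply; apply: int_pair_lt.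
  by rewrite /int_a /int_b /= lt_a leqnn.
have lo1 (b' : 'I_m) : int_b p < b' -> lbl0 T p < T (cell1 b').
  move=> lt_b; have [hb|hb] := ltnP b' (int_a p + k); last first.
    exact: label_cell01_lt.
  have := lo (@IntElt n k m ((int_pair p).1, b') hb).
  rewrite in_inv_ideal; apply; apply: int_pair_lt.
  by rewrite /int_a /int_b /= lt_b leqnn orbT.
have h0 a' := label_cell0_lt T (int_pair p).1 a'.
have h1 b' := label_cell1_lt T (int_pair p).2 b'.
have ha := ltn_ord (int_pair p).1; have hb := ltn_ord (int_pair p).2.
have ne := @label_cell01_neq T (int_pair p).1 (int_pair p).2.
rewrite /active; apply/orP; right; apply/andP; split; apply/eqP.
  have -> : (int_a p + int_b p).+2 = (int_a p).+1 + (int_b p).+1 by lia.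
  apply: label_rank_prefix => // [a'|b'].
    by move: (h0 a'); rewrite /lbl0 /int_a; lia.
  move: (h1 b') (lo1 b') np ne; rewrite /lbl0 /lbl1 /int_b; lia.
rewrite -addnS; apply: label_rank_prefix => // [|a'|b'].
- exact: ltnW.
- move: (label_cell0_lt T a' (int_pair p).1) (lo0 a') np ne.
  rewrite /lbl0 /lbl1 /int_a; lia.
- by move: (h1 b'); rewrite /lbl1 /int_b; lia.
Qed.

(** The mirror image of [addable_active]; the pairs to compare with now all stay inside [Int]. *)
Lemma removable_active T p : p \in (inv_ideal T : {set _}) ->
  (forall q : poset, (p < q)%O -> q \notin (inv_ideal T : {set _})) ->
  active (int_a p + int_b p).+1 T p.
Proof.
rewrite in_inv_ideal => ip up.
have hp : int_b p < int_a p + k := valP p.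
have up0 (a' : 'I_n) : int_a p < a' -> lbl1 T p <= T (cell0 a').
  move=> lt_a; have hb : int_b p < a' + k by lia.
  have := up (@IntElt n k m (a', (int_pair p).2) hb).
  rewrite in_inv_ideal -leqNgt; apply; apply: int_pair_lt.
  by rewrite /int_a /int_b /= lt_a leqnn.
have up1 (b' : 'I_m) : b' < int_b p -> T (cell1 b') <= lbl0 T p.
  move=> lt_b; have hb : b' < int_a p + k by lia.
  have := up (@IntElt n k m ((int_pair p).1, b') hb).
  rewrite in_inv_ideal -leqNgt; apply; apply: int_pair_lt.
  by rewrite /int_a /int_b /= lt_b leqnn orbT.
have h0 a' := label_cell0_lt T (int_pair p).1 a'.
have h1 b' := label_cell1_lt T (int_pair p).2 b'.
have ha := ltn_ord (int_pair p).1; have hb := ltn_ord (int_pair p).2.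
rewrite /active; apply/orP; left; apply/andP; split; apply/eqP.
  rewrite -addSn; apply: label_rank_prefix => // [|a'|b'].
  - exact: ltnW.
  - by move: (h0 a'); rewrite /lbl0 /int_a; lia.
  - move: (label_cell1_lt T b' (int_pair p).2) (up1 b') ip.
    rewrite /lbl0 /lbl1 /int_b; lia.
have -> : (int_a p + int_b p).+2 = (int_a p).+1 + (int_b p).+1 by lia.
apply: label_rank_prefix => // [a'|b'].
  move: (h0 a') (up0 a') (@label_cell01_neq T a' (int_pair p).2) ip.
  rewrite /lbl0 /lbl1 /int_a; lia.
by move: (h1 b'); rewrite /lbl1 /int_b; lia.
Qed.

(** No label lies strictly between two consecutive ones, so [p] can be added or removed freely, and
    both sides change the membership of [p] alone. *)
Lemma toggle_active i T p : 0 < i < n + m -> active i T p ->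
  toggle p (inv_ideal T) = inv_ideal (rho i T).
Proof.
move=> hi act; apply: ideal_inj => q; rewrite in_inv_ideal_rho //.
have -> : active i T q = (q == p).
  by apply/idP/eqP => [act'|->//]; apply: active_uniq act' act.
(* The strict order of [Int] read on labels: going up raises the first-row label and lowers the
   second-row one, at least one of them strictly. *)
have cmp (p1 p2 : poset) : (p1 < p2)%O ->
    [\/ lbl0 T p1 < lbl0 T p2 /\ lbl1 T p2 <= lbl1 T p1 |
        lbl0 T p1 <= lbl0 T p2 /\ lbl1 T p2 < lbl1 T p1].
  move/lt_int_pair.
  have := label_cell0_lt T (int_pair p1).1 (int_pair p2).1.
  have := label_cell0_lt T (int_pair p2).1 (int_pair p1).1.
  have := label_cell1_lt T (int_pair p1).2 (int_pair p2).2.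
  have := label_cell1_lt T (int_pair p2).2 (int_pair p1).2.
  rewrite /lbl0 /lbl1 /int_a /int_b => ? ? ? ? /orP[|] /andP[? ?]; [left|right]; lia.
rewrite /= /toggle_set; have [ip|np] := boolP (p \in inv_set T).
  have -> : [forall q : poset, (p < q)%O ==> (q \notin inv_set T)].
    apply/forallP => r; apply/implyP => lt_pr; rewrite inE.
    move: (cmp _ _ lt_pr) ip act (@label_cell01_neq T (int_pair r).1 (int_pair p).2)
      (@label_cell01_neq T (int_pair p).1 (int_pair r).2).
    rewrite inE /active /lbl0 /lbl1; lia.
  by rewrite /= in_setD1; case: eqP => [->|_]; rewrite ?ip ?addbF.
have -> : [forall q : poset, (q < p)%O ==> (q \in inv_set T)].
  apply/forallP => r; apply/implyP => lt_rp; rewrite inE.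
  move: (cmp _ _ lt_rp) np act (@label_cell01_neq T (int_pair r).1 (int_pair p).2)
    (@label_cell01_neq T (int_pair p).1 (int_pair r).2).
  rewrite inE /active /lbl0 /lbl1; lia.
by rewrite /= in_setU1; case: eqP => [->|_]; rewrite ?(negPf np) ?addbF.
Qed.

Lemma toggle_inactive T p : ~~ active (int_a p + int_b p).+1 T p ->
  toggle p (inv_ideal T) = inv_ideal T.
Proof.
move=> nact; apply: val_inj; rewrite /= /toggle_set.
case: ifP => [/andP[np /forallP lo]|_].
  case/negP: nact; apply: addable_active => // q.
  exact: (implyP (lo q)).
case: ifP => // /andP[ip /forallP up].
case/negP: nact; apply: removable_active => // q.
exact: (implyP (up q)).
Qed.

(** * Products of toggles, and promotion *)

(** At most one listed element is active, and it stays active, hence still the only one, after its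
    toggle has acted; all other toggles are trivial. *)
Lemma foldr_toggle t T (s : seq poset) : t.+1 < n + m -> uniq s ->
    all (fun p => int_a p + int_b p == t) s ->
  foldr (@toggle _ poset) (inv_ideal T) s =
  inv_ideal (if has (active t.+1 T) s then rho t.+1 T else T).
Proof.
move=> ht; elim: s => //= p s IHs /andP[ps us] /andP[/eqP ept es].
rewrite IHs //; case: (boolP (active t.+1 T p)) => [act|nact] /=.
  suff -> : has (active t.+1 T) s = false by apply: toggle_active.
  apply/hasP => -[q qs act']; case/negP: ps.
  by rewrite (active_uniq act act').
case: hasP => [[q qs act]|_]; apply: toggle_inactive; rewrite ept //.
have act' := active_rho (i := t.+1) ht act.
by apply/negP => /(active_uniq act') e; case/negP: ps; rewrite -e.
Qed.

Lemma pro_c_rho t T : t.+1 < n + m ->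
  pro_c t (inv_ideal T) = inv_ideal (rho t.+1 T).
Proof.
move=> ht; rewrite /pro_c (foldr_toggle _ ht) ?filter_uniq ?filter_all //;
  last by rewrite -enumT enum_uniq.
(* With no active element of rank [t], [active_rank] leaves none at all, so [rho t.+1] does not
   change the ideal either. *)
case: hasP => // nact; apply: ideal_inj => q; rewrite in_inv_ideal_rho //.
have [act|_] := boolP (active t.+1 T q); last by rewrite addbF.
case: nact; exists q => //; rewrite mem_filter mem_enum andbT.
by have [<-] := active_rank act.
Qed.

Lemma pro_Pro T : pro (inv_ideal T) = inv_ideal (Pro T).
Proof.
rewrite /pro /Pro skew_size_two_row //.
have : {in iota 0 (n + m).-1, forall t, t.+1 < n + m}.
  by move=> t; rewrite mem_iota; lia.
(* Poset ranks start at 0 and labels at 1, whence the shift by one between the two lists of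
   indices. *)
rewrite (iotaDl 1 0); elim: (iota 0 _) T => //= t s IHs T hs.
rewrite pro_c_rho ?hs ?mem_head // IHs // => u us; apply: hs.
by rewrite inE us orbT.
Qed.

End TwoRow.

Theorem theorem4p12 (n k m : nat) (hm : m <= n + k) :
  exists Phi : ideal (Int n k m) -> syt [:: n + k; m] [:: k],
    bijective Phi /\ Phi \o @pro n k m =1 @Pro [:: n + k; m] [:: k] \o Phi.
Proof.
(* The natural map goes from tableaux to ideals, so [Phi] is its inverse, chosen from surjectivity;
   the intertwining is checked after mapping back to ideals. *)
pose Phi (I : ideal (Int n k m)) := xchoose (inv_ideal_surj hm I).
have PhiK : cancel Phi (inv_ideal hm).
  by move=> I; apply/eqP; apply: (xchooseP (inv_ideal_surj hm I)).
have invK : cancel (inv_ideal hm) Phi.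
  by move=> T; apply: (@inv_ideal_inj n k m hm); rewrite PhiK.
exists Phi; split; first by exists (inv_ideal hm).
by move=> I /=; apply: (@inv_ideal_inj n k m hm); rewrite PhiK -pro_Pro PhiK.
Qed.
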